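(* Let $1\leq p<2$. Let $\omega$ be a continuous non-decreasing function on $[0,+\infty)$ with $\omega(0)=0$, and let $\varphi$ be a nonlinear $C^{1,\omega}$-smooth map of the circle into itself. Then there is a constant $c_p>0$, independent of $n$, such that $$\|e^{in\varphi}\|_{A_p(\mathbb T)}\geq c_p\,|n|^{1/p}\,\chi^{-1}(1/|n|),\qquad n\in\mathbb Z,\quad n\neq 0,$$ where $\chi^{-1}$ is the function inverse to $\chi(\delta)=\delta\,\omega(\delta)$.
   Context: $\mathbb T=\mathbb R/2\pi\mathbb Z$; functions on $\mathbb T$ are identified with $2\pi$-periodic functions on $\mathbb R$. A map of the circle into itself is a function $\varphi:\mathbb R\to\mathbb R$ satisfying $\varphi(t+2\pi)=\varphi(t)\ (\mathrm{mod}\ 2\pi)$ for all $t$. It is $C^{1,\omega}$-smooth if $\varphi\in C^{1,\omega}(\mathbb R)$, i.e. $\varphi$ is differentiable on $\mathbb R$ and $\sup_{|t_1-t_2|\le\delta}|\varphi'(t_1)-\varphi'(t_2)|=O(\omega(\delta))$ as $\delta\to+0$. ''Linear'' means affine, i.e. of the form $at+b$; ''nonlinear'' means not affine. Fourier coefficients: $\widehat f(k)=\frac1{2\pi}\int_0^{2\pi}f(t)e^{-ikt}\,dt$, $k\in\mathbb Z$. $A_1(\mathbb T)$ is the space of continuous functions $f$ on $\mathbb T$ with $\{\widehat f(k)\}\in l^1$; for $1<p\le 2$, $A_p(\mathbb T)$ is the space of integrable functions $f$ on $\mathbb T$ with $\{\widehat f(k)\}\in l^p$. The norm is $\|f\|_{A_p(\mathbb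 T)}=\big(\sum_{k\in\mathbb Z}|\widehat f(k)|^p\big)^{1/p}$. *)

(* Defs.v *)
From HB Require Import structures.
From mathcomp Require Import all_boot all_order all_algebra.
From mathcomp Require Import all_classical all_reals all_analysis.
From mathcomp Require Import complex.

Set Implicit Arguments.
Unset Strict Implicit.
Unset Printing Implicit Defensive.

Import Order.TTheory GRing.Theory Num.Theory numFieldNormedType.Exports.

Local Open Scope classical_set_scope.
Local Open Scope ring_scope.
Local Open Scope complex_scope.

Definition expi (R : realType) (t : R) : R[i] := cos t +i* sin t.

Definition Cintegral (R : realType) (D : set R) (f : R -> R[i]) : R[i] :=
  (\int[lebesgue_measure]_(t in D) complex.Re (f t)) +i*
  (\int[lebesgue_measure]_(t in D) complex.Im (f t)).

(* Functions on R/2piZ are represented by 2pi-periodic functions on R. *)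
Definition fourier_coef (R : realType) (f : R -> R[i]) (k : int) : R[i] :=
  ((2 * pi)^-1)%:C *
  Cintegral `[0, 2 * pi] (fun t => f t * expi (- (k%:~R * t))).

(* Valued in \bar R: it is +oo when the Fourier coefficients are not in l^p. *)
Definition Ap_norm (R : realType) (p : R) (f : R -> R[i]) : \bar R :=
  ((\esum_(k in [set: int]) (Normc.normc (fourier_coef f k) `^ p)%:E) `^ p^-1)%E.

Definition circle_map (R : realType) (phi : R -> R) : Prop :=
  forall t, exists m : int, phi (t + 2 * pi) = phi t + m%:~R * (2 * pi).

(* Valued in \bar R so that an unbounded oscillation gives +oo. *)
Definition modulus_of_continuity (R : realType) (f : R -> R) (delta : R) :
    \bar R :=
  ereal_sup [set `|f u.1 - f u.2|%:E | u in
              [set u : R * R | `|u.1 - u.2| <= delta]].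

Definition C1_smooth (R : realType) (omega phi : R -> R) : Prop :=
  (forall t, derivable phi t 1) /\
  exists C : R, \forall delta \near (0 : R)^'+,
    (modulus_of_continuity (derive1 phi) delta <= (C * omega delta)%:E)%E.

Definition affine (R : realType) (phi : R -> R) : Prop :=
  exists a b : R, forall t, phi t = a * t + b.

Definition chi (R : realType) (omega : R -> R) (delta : R) : R :=
  delta * omega delta.

(* The inverse of chi : [0, +oo[ -> [0, +oo[, a bijection as soon as omega > 0
   on ]0, +oo[. That holds if some non-affine phi is C1_smooth omega:
   otherwise omega = 0 near 0, so its derivative is locally constant. *)
Definition chi_inv (R : realType) (omega : R -> R) : R -> R :=
  'pinv_(fun=> 0) `[0, +oo[ (chi omega).

(* Main.v *)
Require Import Defs.
From HB Require Import structures.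
From mathcomp Require Import all_boot all_order all_algebra.
From mathcomp Require Import all_classical all_reals all_analysis.
From mathcomp Require Import complex.
From mathcomp Require Import zify ring lra.

Set Implicit Arguments.
Unset Strict Implicit.
Unset Printing Implicit Defensive.

Import Order.TTheory GRing.Theory Num.Theory numFieldNormedType.Exports.

Local Open Scope classical_set_scope.
Local Open Scope ring_scope.

(** Write f = expi (n phi), a_j = |f^(j)| and delta = chi_inv (1/|n|), so that
    |n| * delta * omega delta = 1; if 1/|n| is not a value of chi then delta is
    the default value 0 and there is nothing to prove ([chi_inv_spec]).

    If phi'(t0) is close to k/n, then on an interval of length h = eta * delta
    around t0 the function f is almost the pure exponential of frequency k:
    by the mean value theorem the phase n phi(t) - k t varies there by at most
    h * (|n| * C * omega h + 1), which is small once eta is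
    ([phase_almost_constant]). Testing f against a nonnegative trigonometric
    polynomial K concentrated within O(h) of t0, of degree less than N ~ 1/h,
    therefore loses only a fraction of the mass of K. As K is the squared
    modulus of sum_m b_m e^(imt), this reads
      1/2 * sum_m b_m^2 <= sum_(i,j) b_i b_j a_(k-i+j)
    ([fourier_peak]): the coefficients of index within N of k carry mass.

    The derivative of phi is continuous, 2pi-periodic and not constant, so its
    values at points staying away from 0 and 2pi fill an
    interval [A, B] with A < B ([derive1_range]). Hence the estimate above holds
    for at least |n| (B - A) integers k ([integer_frequencies]). Raising it to
    the power p and summing over these k gives
      sum_j a_j^p >= |n| (B - A) / (4N)^p
    ([lp_lower_bound]), because each a_j is counted with total weight at most
    (sum_i b_i)^2 <= N * sum_i b_i^2. The p-th root of this is the theorem, since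
    1/N is of the order of delta.

    The weights are b_m = sin (m pi / N), for which the second moment of K is
    explicit: b is an eigenvector of the discrete Laplacian with zero boundary
    values, and so
    int (1 - cos (t - t0)) K(t - t0) dt = (1 - cos (pi/N)) int K. This quadratic
    concentration makes it possible to bound cos (n phi(t) - k t - theta) from
    below by 3/4 - (16/h^2) (1 - cos (t - t0)) on the whole circle, and integrate
    this inequality without cutting the integral into pieces. *)

(** * Elementary estimates *)

Lemma derivable_continuous (R : realType) (f : R -> R) :
  (forall t, derivable f t 1) -> continuous f.
Proof. by move=> df t; exact/differentiable_continuous/derivable1_diffP. Qed.

Lemma MVT_derivable (R : realType) (f : R -> R) (x y : R) :
  (forall t, derivable f t 1) ->
  exists2 c, `|c - x| <= `|y - x| & f y - f x = derive1 f c * (y - x).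
Proof.
move=> df.
have dI (t : R) : is_derive t 1 f (derive1 f t) by rewrite derive1E; exact: DeriveDef.
case: (leP x y) => xy.
- have [|c] := @MVT_segment R f (derive1 f) x y xy.
  by apply: continuous_subspaceT; exact: derivable_continuous.
  rewrite in_itv /= => /andP[xc cy] E; exists c => //.
  by rewrite !ger0_norm; lra.
- have [|c] := @MVT_segment R f (derive1 f) y x (ltW xy).
  by apply: continuous_subspaceT; exact: derivable_continuous.
  rewrite in_itv /= => /andP[xc cy] E; exists c; last lra.
  by rewrite !ler0_norm; lra.
Qed.

Lemma norm_sin_le (R : realType) (x : R) : `|sin x| <= `|x|.
Proof.
have [c _] := @MVT_derivable R sin 0 x (@derivable_sin R).
rewrite sin0 !subr0 => ->; rewrite normrM derive1E derive_val.
by rewrite ler_piMl// cos_max.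
Qed.

Lemma cos_ge_parabola (R : realType) (x : R) : 1 - x ^+ 2 / 2 <= cos x.
Proof.
have -> : cos x = 1 - sin (x / 2) ^+ 2 *+ 2.
  have E : x = (x / 2) *+ 2 by field.
  by rewrite {1}E cos_mulr2n (cos2sin2 (_ / 2)); ring.
have := norm_sin_le (x / 2).
rewrite -ler_sqr ?nnegrE// !real_normK ?num_real// => h.
have E2 : (x / 2) ^+ 2 = x ^+ 2 / 4 by field.
rewrite E2 in h.
lra.
Qed.

(** Writing sin x = 2 sin (x/2) cos (x/2), the mean value theorem gives
    sin (x/2) >= (x/2) cos (x/2), and cos^2 (x/2) >= 1/2 on this interval. *)
Lemma sin_ge_half (R : realType) (x : R) : 0 <= x <= pi / 2 -> x / 2 <= sin x.
Proof.
move=> /andP[x0 xpi].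
have pi0 := @pi_gt0 R.
have cx0 : 0 <= cos x by apply: cos_ge0_pihalf; lra.
have h2 : x / 2 * cos (x / 2) <= sin (x / 2).
  have [c hc] := @MVT_derivable R sin 0 (x / 2) (@derivable_sin R).
  rewrite sin0 !subr0 => ->; rewrite derive1E derive_val mulrC.
  rewrite ler_wpM2r//; first lra.
  rewrite !subr0 in hc.
  rewrite -(cos_norm c).
  have h0 : 0 <= x / 2 by lra.
  rewrite (ger0_norm h0) in hc.
  have cn := normr_ge0 c.
  rewrite leNgt ltr_cos ?in_itv/= -?leNgt //; lra.
have cc0 : 0 <= cos (x / 2) by apply: cos_ge0_pihalf; lra.
have E : x = (x / 2) *+ 2 by field.
have cc : cos (x / 2) ^+ 2 >= 1 / 2.
  by move: cx0; rewrite {1}E cos_mulr2n; lra.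
rewrite {2}E sin_mulr2n.
have := ler_wpM2l cc0 h2.
set cv := cos _ in cc cc0 *; move=> h.
have : x / 2 * (1 / 2) <= x / 2 * cv ^+ 2 by rewrite ler_wpM2l//; lra.
lra.
Qed.

(** The condition on s says that it stays at distance h from 2pi Z, within
    one turn; the bound is that of |sin (s/2)|, by reflection about pi/2. *)
Lemma one_sub_cos_lower (R : realType) (h s : R) : 0 <= h -> h <= `|s| <= 2 * pi - h ->
  h ^+ 2 / 8 <= 1 - cos s.
Proof.
move=> h0 /andP[hs sp].
rewrite -(cos_norm s); set y := `|s| in hs sp *.
have -> : cos y = 1 - sin (y / 2) ^+ 2 *+ 2.
  have E : y = (y / 2) *+ 2 by field.
  by rewrite {1}E cos_mulr2n (cos2sin2 (_ / 2)); ring.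
suff : h / 4 <= sin (y / 2).
  move=> H; have : (h / 4) ^+ 2 <= sin (y / 2) ^+ 2.
    by rewrite ler_sqr ?nnegrE//; lra.
  have E3 : (h / 4) ^+ 2 = h ^+ 2 / 16 by field.
  by rewrite E3; lra.
case: (leP y pi) => yp.
  by apply: le_trans (sin_ge_half _); lra.
have -> : sin (y / 2) = sin (pi - y / 2).
  by rewrite sinB sinpi cospi; ring.
by apply: le_trans (sin_ge_half _); lra.
Qed.

(** * A concentrated nonnegative kernel *)

Section Kernel.
Variable R : realType.
Implicit Types x s a : R.

(** The squared modulus of the trigonometric polynomial
    sum_(m < N) sin (m x) e^(ims), split into its real and imaginary parts. *)
Definition kernel (N : nat) (x s : R) : R :=
  (\sum_(i < N) sin (i%:R * x) * cos (i%:R * s)) ^+ 2 +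
  (\sum_(i < N) sin (i%:R * x) * sin (i%:R * s)) ^+ 2.

Lemma kernel_ge0 N x s : 0 <= kernel N x s.
Proof. by rewrite addr_ge0// sqr_ge0. Qed.

(** This is the real part of e^(ia) |sum_m b_m e^(ims)|^2, expanded as a double
    sum: multiplication by the kernel only shifts frequencies. *)
Lemma cos_mul_kernel N x a s : cos a * kernel N x s =
  \sum_(i < N) \sum_(j < N)
    sin (i%:R * x) * sin (j%:R * x) * cos (a + (i%:R - j%:R) * s).
Proof.
pose b (i : 'I_N) := sin (i%:R * x).
pose C := \sum_(i < N) b i * cos (i%:R * s).
pose S := \sum_(i < N) b i * sin (i%:R * s).
have inner (i : 'I_N) : \sum_(j < N) b i * b j * cos (a + (i%:R - j%:R) * s) =
    b i * cos (i%:R * s) * (cos a * C + sin a * S) +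
    b i * sin (i%:R * s) * (cos a * S - sin a * C).
  rewrite (_ : _ + _ = b i * cos (a + i%:R * s) * C + b i * sin (a + i%:R * s) * S).
    rewrite !mulr_sumr -big_split/=; apply: eq_bigr => j _.
    by rewrite mulrBl addrA cosB; ring.
  by rewrite cosD sinD; ring.
under eq_bigr do rewrite inner.
by rewrite big_split/= -!mulr_suml -/C -/S /kernel -/C -/S; ring.
Qed.

(** Since 2 cos x sin (m x) = sin ((m+1) x) + sin ((m-1) x), the summand is a
    difference of consecutive products of adjacent weights, and telescopes. *)
Lemma sum_sin_adjacent N x :
  \sum_(i < N) (2 * (sin (i%:R * x) * sin (i.+1%:R * x)) - 2 * cos x * sin (i%:R * x) ^+ 2)
  = sin (N%:R * x) * (sin (N%:R * x) * cos x - cos (N%:R * x) * sin x).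
Proof.
elim: N => [|N IH]; first by rewrite big_ord0 mul0r sin0 mul0r.
have E : N.+1%:R * x = N%:R * x + x by rewrite -natr1; ring.
rewrite big_ord_recr /= IH E sinD cosD.
set S := sin (N%:R * x); set C := cos (N%:R * x).
transitivity ((S * cos x + C * sin x) * (S * (cos x ^+ 2 + sin x ^+ 2))).
  by rewrite cos2Dsin2; ring.
by ring.
Qed.

Lemma sum_sin_adjacent_pi N : (0 < N)%N ->
  \sum_(i < N) sin (i%:R * (pi / N%:R)) * sin (i.+1%:R * (pi / N%:R)) =
  cos (pi / N%:R) * \sum_(i < N) sin (i%:R * (pi / N%:R)) ^+ 2 :> R.
Proof.
move=> N0; have := sum_sin_adjacent N (pi / N%:R).
have -> : N%:R * (pi / N%:R) = pi :> R.
  by rewrite mulrC divfK// pnatr_eq0 -lt0n.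
rewrite sinpi mul0r sumrB -!mulr_sumr; lra.
Qed.

(** Cauchy-Schwarz against the constant weight, through
    b_i b_j <= (b_i^2 + b_j^2) / 2. *)
Lemma sum_mul_le N (b : 'I_N -> R) :
  \sum_(i < N) \sum_(j < N) b i * b j <= N%:R * \sum_(i < N) b i ^+ 2.
Proof.
have -> : N%:R * \sum_(i < N) b i ^+ 2 =
  \sum_(i < N) \sum_(j < N) (b i ^+ 2 / 2 + b j ^+ 2 / 2).
  under [RHS]eq_bigr do rewrite big_split/= sumr_const card_ord.
  rewrite big_split/= sumr_const card_ord sumrMnl -!mulr_suml.
  rewrite -mulr_natl -[X in _ = _ + X]mulr_natl.
  by field.
apply: ler_sum => i _; apply: ler_sum => j _.
have := sqr_ge0 (b i - b j); rewrite sqrrB -mulr_natr; lra.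
Qed.
End Kernel.

(** * Integrals over one period *)

Section Circle.
Variable R : realType.
Local Notation pi := (@pi R).

Definition circle_integral (f : R -> R) : R :=
  \int[lebesgue_measure]_(t in `[0, 2 * pi]) f t.

Lemma pi2_gt0 : 0 < 2 * pi.
Proof. by rewrite mulr_gt0// pi_gt0. Qed.

Lemma circle_integrable (f : R -> R) : continuous f ->
  lebesgue_measure.-integrable `[0, 2 * pi] (EFin \o f).
Proof.
move=> cf; apply: continuous_compact_integrable; first exact: segment_compact.
exact: continuous_subspaceT.
Qed.

Lemma circle_integralZ (c : R) (f : R -> R) : continuous f ->
  circle_integral (fun t => c * f t) = c * circle_integral f.
Proof. by move=> cf; apply: RintegralZl => //; exact: circle_integrable. Qed.

Lemma circle_integralD (f g : R -> R) : continuous f -> continuous g ->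
  circle_integral (fun t => f t + g t) = circle_integral f + circle_integral g.
Proof. by move=> cf cg; apply: RintegralD => //; exact: circle_integrable. Qed.

Lemma le_circle_integral (f g : R -> R) : continuous f -> continuous g ->
  (forall t, 0 <= t <= 2 * pi -> f t <= g t) ->
  circle_integral f <= circle_integral g.
Proof.
move=> cf cg fg; apply: le_Rintegral => //.
- exact: circle_integrable.
- exact: circle_integrable.
Qed.

Lemma sum_continuous (I : Type) (r : seq I) (f : I -> R -> R) :
  (forall i, continuous (f i)) -> continuous (fun t => \sum_(i <- r) f i t).
Proof.
move=> cf t; elim: r => [|i r IH].
  by under [X in continuous_at _ X]eq_fun do rewrite big_nil; exact: cvg_cst.
under [X in continuous_at _ X]eq_fun do rewrite big_cons.
by apply: cvgD => //; exact: cf.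
Qed.

Lemma circle_integral_sum (I : Type) (r : seq I) (f : I -> R -> R) :
  (forall i, continuous (f i)) ->
  circle_integral (fun t => \sum_(i <- r) f i t) = \sum_(i <- r) circle_integral (f i).
Proof.
move=> cf; elim: r => [|i r IH].
  rewrite big_nil -[RHS](mul0r (circle_integral (cst 0))) -circle_integralZ;
    last exact: cst_continuous.
  by apply: eq_Rintegral => t _; rewrite big_nil mul0r.
rewrite big_cons -IH -circle_integralD//; last exact: sum_continuous.
by apply: eq_Rintegral => t _; rewrite big_cons.
Qed.

Lemma continuous_scale (c : R) (f : R -> R) : continuous f -> continuous (fun t => c * f t).
Proof. by move=> cf t; apply: cvgM; [exact: cvg_cst|exact: cf]. Qed.

Lemma continuous_cosf (f : R -> R) : continuous f -> continuous (fun t => cos (f t)).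
Proof. by move=> cf t; apply: continuous_comp; [exact: cf|exact: continuous_cos]. Qed.

Lemma continuous_affine_phase (c t0 : R) : continuous (fun t : R => c * (t - t0)).
Proof.
by apply: continuous_scale => t; apply: cvgB; [exact: cvg_id|exact: cvg_cst].
Qed.

Lemma sin_int_pi2 (l : int) (a : R) : sin (a + l%:~R * (2 * pi)) = sin a.
Proof.
have sin_nat (n : nat) (b : R) : sin (b + n%:R * (2 * pi)) = sin b.
  elim: n => [|n IH]; first by rewrite mul0r addr0.
  have -> : b + n.+1%:R * (2 * pi) = b + n%:R * (2 * pi) + pi *+ 2.
    by rewrite -natr1; ring.
  by rewrite sinD2pi.
case: (intP l) => [|n|n]; first by rewrite mul0r addr0.
  exact: sin_nat.
rewrite -[LHS](sin_nat n.+1) mulrNz; congr sin.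
by rewrite -[n.+1%:~R]/(n.+1%:R); ring.
Qed.

Lemma circle_integral_cos (l : int) (t0 : R) :
  circle_integral (fun t => cos (l%:~R * (t - t0))) = (2 * pi) *+ (l == 0).
Proof.
have p2 := pi2_gt0.
have [->|l0] := eqVneq l 0.
  rewrite /circle_integral; under eq_Rintegral do rewrite mul0r cos0.
  rewrite Rintegral_cst //= mul1r.
  rewrite lebesgue_measure_itv/= lte_fin p2 /=.
  by rewrite subr0.
have l0R : l%:~R != 0 :> R by rewrite intr_eq0.
pose F (t : R) := sin (l%:~R * (t - t0)) / l%:~R.
have dF (t : R) : is_derive t 1 F (cos (l%:~R * (t - t0))).
  rewrite /F.
  apply: is_derive_eq.
  by rewrite /GRing.scale/=; field.
rewrite /circle_integral /Rintegral (@continuous_FTC2 _ _ F)//.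
- have E : l%:~R * (2 * pi - t0) = l%:~R * (0 - t0) + l%:~R * (2 * pi) by ring.
  by rewrite /F /= E sin_int_pi2 subrr.
- apply: continuous_subspaceT; apply: continuous_cosf.
  exact: continuous_affine_phase.
- have cF : continuous F by apply: derivable_continuous => t.
  split => //.
  + by apply: cvg_at_right_filter; exact: cF.
  + by apply: cvg_at_left_filter; exact: cF.
- by move=> t _; rewrite derive1E derive_val.
Qed.

Lemma kernel_continuous (N : nat) (x t0 : R) : continuous (fun t => kernel N x (t - t0)).
Proof.
suff -> : (fun t => kernel N x (t - t0)) = (fun t => \sum_(i < N) \sum_(j < N)
    sin (i%:R * x) * sin (j%:R * x) * cos ((i%:R - j%:R) * (t - t0))).
  do 2 (apply: sum_continuous => ?).
  apply: continuous_scale; apply: continuous_cosf; exact: continuous_affine_phase.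
apply/funext => t; transitivity (cos 0 * kernel N x (t - t0)).
  by rewrite cos0 mul1r.
rewrite cos_mul_kernel.
by apply: eq_bigr => i _; apply: eq_bigr => j _; rewrite add0r.
Qed.

Lemma circle_integral_phase_kernel (N : nat) (x t0 : R) (alpha : R -> R) : continuous alpha ->
  circle_integral (fun t => cos (alpha t) * kernel N x (t - t0)) =
  \sum_(i < N) \sum_(j < N) sin (i%:R * x) * sin (j%:R * x) *
     circle_integral (fun t => cos (alpha t + (i%:R - j%:R) * (t - t0))).
Proof.
move=> ca.
have cterm (i j : 'I_N) : continuous (fun t => cos (alpha t + (i%:R - j%:R) * (t - t0))).
  apply: continuous_cosf => t; apply: cvgD; first exact: ca.
  exact: continuous_affine_phase.
have cmul (i j : 'I_N) : continuous (fun t => sin (i%:R * x) * sin (j%:R * x) *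
     cos (alpha t + (i%:R - j%:R) * (t - t0))).
  exact: continuous_scale.
rewrite /circle_integral; under eq_Rintegral do rewrite cos_mul_kernel.
rewrite -/(circle_integral _) circle_integral_sum; last first.
  by move=> i; exact: sum_continuous.
apply: eq_bigr => i _; rewrite circle_integral_sum//.
by apply: eq_bigr => j _; rewrite circle_integralZ.
Qed.

(** Orthogonality selects the pairs (i, j) whose frequencies cancel e. The
    cases e = 0 and e = 1 give the mass and the first cosine moment of the
    kernel. *)
Lemma circle_integral_cos_kernel (N : nat) (x t0 : R) (e : nat) :
  circle_integral (fun t => cos (e%:R * (t - t0)) * kernel N x (t - t0)) =
  2 * pi * \sum_(i < N) \sum_(j < N)
    sin (i%:R * x) * sin (j%:R * x) *+ (j == (i + e)%N :> nat).
Proof.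
rewrite circle_integral_phase_kernel; last first.
  by apply: continuous_affine_phase.
rewrite mulr_sumr; apply: eq_bigr => i _; rewrite mulr_sumr; apply: eq_bigr => j _.
have := circle_integral_cos (e%:Z + i%:Z - j%:Z) t0.
rewrite [X in _ *+ X](_ : nat_of_bool _ = nat_of_bool (j == (i + e)%N :> nat)); last first.
  by congr nat_of_bool; rewrite subr_eq0 -PoszD eqz_nat eq_sym addnC.
under [X in circle_integral X = _ -> _]funext do
  rewrite rmorphB rmorphD/= -!pmulrn mulrBl mulrDl -addrA -mulrBl.
by move=> ->; rewrite mulrnAr mulrnAr; congr (_ *+ _); ring.
Qed.

Lemma circle_integral_kernel (N : nat) (x t0 : R) :
  circle_integral (fun t => kernel N x (t - t0)) =
  2 * pi * \sum_(i < N) sin (i%:R * x) ^+ 2.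
Proof.
transitivity (circle_integral (fun t => cos (0%:R * (t - t0)) * kernel N x (t - t0))).
  by apply: eq_Rintegral => t _; rewrite mul0r cos0 mul1r.
rewrite circle_integral_cos_kernel; congr (_ * _); apply: eq_bigr => i _.
rewrite (bigD1 i)//= addn0 eqxx big1 ?addr0 => [|j ji]; first by rewrite mulr1n expr2.
by rewrite -val_eqE in ji; rewrite (negbTE ji).
Qed.

(** At x = pi / N the weights vanish at 0 and N, so that no boundary term
    appears and the sum of the products of adjacent weights is cos x times the
    sum of their squares. *)
Lemma circle_integral_shifted_kernel (N : nat) (t0 : R) : (0 < N)%N ->
  circle_integral (fun t => cos (t - t0) * kernel N (pi / N%:R) (t - t0)) =
  2 * pi * (cos (pi / N%:R) * \sum_(i < N) sin (i%:R * (pi / N%:R)) ^+ 2).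
Proof.
move=> N0.
transitivity (circle_integral (fun t =>
    cos (1%:R * (t - t0)) * kernel N (pi / N%:R) (t - t0))).
  by apply: eq_Rintegral => t _; rewrite mul1r.
rewrite circle_integral_cos_kernel -sum_sin_adjacent_pi//; congr (_ * _).
apply: eq_bigr => i _; rewrite addn1; case: (ltnP i.+1 N) => iN.
  rewrite (bigD1 (Ordinal iN))//= eqxx big1 ?addr0 ?mulr1n// => j.
  by rewrite -val_eqE /= => /negbTE ->.
rewrite big1 => [|j _].
  have -> : i.+1 = N by apply/eqP; rewrite eqn_leq iN ltn_ord.
  by rewrite mulrC [N%:R * _]mulrC divfK ?pnatr_eq0 -?lt0n// sinpi mul0r.
by rewrite ltn_eqF// (leq_trans (ltn_ord j)).
Qed.

(** The minorant 3/4 - (16/h^2) (1 - cos (t - t0)) is integrated exactly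
    against the kernel; its average is at least 1/2, since
    (16/h^2) (1 - cos (pi/N)) <= 8 pi^2 / (N h)^2 <= 1/4, because pi <= 4. *)
Lemma kernel_peak (N : nat) (alpha : R -> R) (t0 h : R) :
  continuous alpha -> 0 < h -> 24 <= N%:R * h ->
  (forall t, 0 <= t <= 2 * pi ->
     3 / 4 - 16 / h ^+ 2 * (1 - cos (t - t0)) <= cos (alpha t)) ->
  pi * \sum_(i < N) sin (i%:R * (pi / N%:R)) ^+ 2 <=
  \sum_(i < N) \sum_(j < N) sin (i%:R * (pi / N%:R)) * sin (j%:R * (pi / N%:R)) *
     circle_integral (fun t => cos (alpha t + (i%:R - j%:R) * (t - t0))).
Proof.
move=> ca h0 Nh hlow.
have N0 : (0 < N)%N.
  by case: N Nh => // ; rewrite mul0r; lra.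
have NR : 0 < N%:R :> R by rewrite ltr0n.
rewrite -circle_integral_phase_kernel//.
set x := pi / N%:R; set Q := \sum_(i < N) _.
pose K t := kernel N x (t - t0).
have cK : continuous K by exact: kernel_continuous.
have ccK : continuous (fun t => cos (t - t0) * K t).
  have cc : continuous (fun t => cos (t - t0)).
    by apply: continuous_cosf => t; apply: cvgB; [exact: cvg_id|exact: cvg_cst].
  by move=> t; apply: cvgM; [exact: cc|exact: cK].
pose B := 16 / h ^+ 2.
have Q0 : 0 <= Q by apply: sumr_ge0 => i _; exact: sqr_ge0.
have lowint : circle_integral (fun t => (3 / 4 - B) * K t + B * (cos (t - t0) * K t))
   = 2 * pi * Q * (3 / 4 - B * (1 - cos x)).
  rewrite circle_integralD; [|exact: continuous_scale..].
  rewrite !circle_integralZ// /K circle_integral_kernel circle_integral_shifted_kernel//.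
  by rewrite -/Q -/x; ring.
have pi4 : pi <= 4 by have := @pihalf_lt2 R; lra.
have B0 : 0 <= B by rewrite divr_ge0// ltW// exprn_gt0.
have Bx : B * (1 - cos x) <= 1 / 4.
  have hc := cos_ge_parabola x.
  have : B * (1 - cos x) <= B * (x ^+ 2 / 2) by rewrite ler_wpM2l//; lra.
  move/le_trans; apply.
  have -> : B * (x ^+ 2 / 2) = 8 * (pi / (N%:R * h)) ^+ 2.
    by rewrite /B /x; field; rewrite !gt_eqF.
  have : pi / (N%:R * h) <= 1 / 6.
    by rewrite ler_pdivrMr ?mulr_gt0//; lra.
  have := @pi_gt0 R => p0 hq.
  have q0 : 0 <= pi / (N%:R * h) by rewrite divr_ge0// ltW// mulr_gt0.
  have : (pi / (N%:R * h)) ^+ 2 <= (1 / 6) ^+ 2 by rewrite lerXn2r ?nnegrE//; lra.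
  lra.
apply: (@le_trans _ _ (2 * pi * Q * (3 / 4 - B * (1 - cos x)))).
  have : 0 <= pi * Q by rewrite mulr_ge0// pi_ge0.
  set y := pi * Q => y0.
  have -> : 2 * pi * Q * (3 / 4 - B * (1 - cos x)) = y * (2 * (3 / 4 - B * (1 - cos x))).
    by rewrite /y; ring.
  by rewrite ler_peMr//; lra.
rewrite -lowint; apply: le_circle_integral.
- move=> t; apply: cvgD; first exact: (continuous_scale cK).
  exact: (continuous_scale ccK).
- by move=> t; apply: cvgM; [exact: (continuous_cosf ca)|exact: cK].
move=> t /hlow; rewrite -/B => H.
have := ler_wpM2r (kernel_ge0 N x (t - t0)) H.
by rewrite -/(K t); lra.
Qed.
End Circle.

(** * Fourier coefficients near a frequency *)

Section Fourier.
Variable R : realType.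
Local Notation pi := (@pi R).

Lemma normc_ge_dot (z : R[i]) (theta : R) :
  cos theta * complex.Re z + sin theta * complex.Im z <= Normc.normc z.
Proof.
case: z => u v /=; set c := cos theta; set s := sin theta.
have cs : c ^+ 2 + s ^+ 2 = 1 by exact: cos2Dsin2.
apply: le_trans (ler_norm _) _.
rewrite -sqrtr_sqr ler_wsqrtr//.
have -> : u ^+ 2 + v ^+ 2 = (c ^+ 2 + s ^+ 2) * (u ^+ 2 + v ^+ 2) by rewrite cs mul1r.
have := sqr_ge0 (c * v - s * u); lra.
Qed.

(** Up to the factor 2pi, the integral is the scalar product of the
    coefficient, seen as a plane vector, with the unit vector of angle theta. *)
Lemma cos_integral_le_fourier_coef (psi : R -> R) (j : int) (theta : R) :
  continuous psi ->
  circle_integral (fun t => cos (psi t - j%:~R * t - theta)) <=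
  2 * pi * Normc.normc (fourier_coef (fun t => expi (psi t)) j).
Proof.
move=> cpsi.
pose ph t := psi t - j%:~R * t.
have cph : continuous ph.
  move=> t; apply: cvgB; first exact: cpsi.
  by apply: cvgM; [exact: cvg_cst|exact: cvg_id].
have csin : continuous (fun t => sin (ph t)).
  by move=> t; apply: continuous_comp; [exact: cph|exact: continuous_sin].
have ccos := continuous_cosf cph.
have RE (t : R) : expi (psi t) * expi (- (j%:~R * t)) = expi (ph t).
  by rewrite /expi /ph cosD sinD; simpc; congr (_ +i* _)%C; ring.
rewrite /fourier_coef /Cintegral.
under [X in Complex (Rintegral _ _ X) _]funext do rewrite RE/=.
under [X in Complex _ (Rintegral _ _ X)]funext do rewrite RE/=.
rewrite -/(circle_integral _) -/(circle_integral (fun t => sin (ph t))).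
set Ic := circle_integral (fun t => cos (ph t)).
set Is := circle_integral (fun t => sin (ph t)).
have -> : circle_integral (fun t => cos (psi t - j%:~R * t - theta)) =
    cos theta * Ic + sin theta * Is.
  rewrite /Ic /Is -!circle_integralZ// -circle_integralD; [|exact: continuous_scale..].
  by apply: eq_Rintegral => t _; rewrite cosB /ph; ring.
have := normc_ge_dot (((2 * pi)^-1)%:C * (Ic +i* Is))%C theta.
have p2 := @pi2_gt0 R.
rewrite -(ler_pM2l p2) => /(le_trans _); apply; simpc => /=.
have p0 := @pi_gt0 R; clearbody Ic Is; clear p2; move: (@trigo.pi R) p0 => q q0.
by rewrite le_eqVlt; apply/orP; left; apply/eqP; field; rewrite gt_eqF.
Qed.

(** The term (i, j) in the expansion of [kernel_peak] is the integral of
    cos (psi t - (k - i + j) t - const), so it is controlled by the coefficient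
    of index k - i + j. *)
Lemma fourier_peak (psi : R -> R) (k : int) (theta t0 h : R) (N : nat) :
  continuous psi -> 0 < h -> 24 <= N%:R * h ->
  (forall t, 0 <= t <= 2 * pi ->
     3 / 4 - 16 / h ^+ 2 * (1 - cos (t - t0)) <= cos (psi t - k%:~R * t - theta)) ->
  (\sum_(i < N) sin (i%:R * (pi / N%:R)) ^+ 2) / 2 <=
  \sum_(i < N) \sum_(j < N) sin (i%:R * (pi / N%:R)) * sin (j%:R * (pi / N%:R)) *
     Normc.normc (fourier_coef (fun t => expi (psi t)) (k - i%:Z + j%:Z)).
Proof.
move=> cpsi h0 Nh low.
have NR : 0 < N%:R :> R by case: N Nh => //; rewrite mul0r; lra.
have ca : continuous (fun t => psi t - k%:~R * t - theta).
  move=> t; apply: cvgB; last exact: cvg_cst.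
  apply: cvgB; first exact: cpsi.
  by apply: cvgM; [exact: cvg_cst|exact: cvg_id].
have p2 := @pi2_gt0 R.
rewrite -(ler_pM2l p2).
set Q := \sum_(i < N) _ ^+ 2.
have -> : 2 * pi * (Q / 2) = pi * Q by field.
apply: le_trans (kernel_peak ca h0 Nh low) _.
rewrite mulr_sumr; apply: ler_sum => i _.
rewrite mulr_sumr; apply: ler_sum => j _.
rewrite [leRHS]mulrCA ler_wpM2l//.
  have sin0 (l : 'I_N) : 0 <= sin (l%:R * (pi / N%:R)).
    have p0 := @pi_ge0 R.
    apply: sin_ge0_pi; rewrite mulr_ge0 ?divr_ge0//= mulrCA ler_piMr//.
    by rewrite ler_pdivrMr// mul1r ler_nat ltnW.
  by rewrite mulr_ge0.
apply: le_trans (cos_integral_le_fourier_coef _ (theta + (i%:R - j%:R) * t0) cpsi).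
rewrite le_eqVlt; apply/orP; left; apply/eqP; apply: eq_Rintegral => t _; congr cos.
by rewrite rmorphD rmorphB /= -!pmulrn; ring.
Qed.
End Fourier.

(** * From local mass to the l^p norm *)

Section Lp.
Variable R : realType.

(** A linear minorant of a^p with constants weaker than those of the tangent at
    b: it is negative for a < b, and for a >= b one has a^(p-1) >= b^(p-1). *)
Lemma powR_ge_linear (p a b : R) : 1 <= p -> 0 <= a -> 0 < b ->
  b `^ (p - 1) * (a - b) <= a `^ p.
Proof.
move=> p1 a0 b0; case: (leP a b) => ab.
  by apply: le_trans (powR_ge0 _ _); rewrite mulr_ge0_le0 ?powR_ge0 ?subr_le0.
have q0 : 0 <= p - 1 by lra.
rewrite -[leRHS]mulr_powRB1//; last lra.
have := @ge0_ler_powR R _ q0 b a; rewrite !nnegrE => /(_ (ltW b0) a0 (ltW ab)) /= h.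
have b1 := powR_ge0 b (p - 1).
apply: (@le_trans _ _ (b `^ (p - 1) * a)); first by rewrite ler_wpM2l//; lra.
by rewrite mulrC ler_wpM2l.
Qed.

Lemma sum_le_esum (T : choiceType) (a : T -> R) (s : seq T) : uniq s ->
  (forall k, 0 <= a k) ->
  ((\sum_(k <- s) a k)%:E <= \esum_(k in [set: T]) (a k)%:E)%E.
Proof.
move=> us a0; apply: esum_ge; exists [set` s].
  by split => //; exact: finite_seq.
by rewrite -fsbig_seq// sumEFin.
Qed.

(** Jensen's inequality in disguise: with beta = 1/(4N) the linear minorant of
    a^p at beta turns the hypothesis into a lower bound for
    sum_(i,j) b_i b_j a_(k-i+j)^p. Summed over k in s, for fixed i and j the
    indices k - i + j are distinct, so the result is at most the full l^p sum
    times (sum_i b_i)^2. *)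
Lemma lp_lower_bound (p : R) (N : nat) (b : 'I_N -> R) (a : int -> R) (s : seq int) :
  1 <= p -> (0 < N)%N -> (forall i, 0 <= b i) -> 0 < \sum_(i < N) b i ^+ 2 ->
  (forall k, 0 <= a k) -> uniq s ->
  (forall k, k \in s -> (\sum_(i < N) b i ^+ 2) / 2 <=
     \sum_(i < N) \sum_(j < N) b i * b j * a (k - i%:Z + j%:Z)) ->
  (((size s)%:R * (4 * N%:R)^-1 `^ p)%:E <= \esum_(k in [set: int]) (a k `^ p)%:E)%E.
Proof.
move=> p1 N0 b0; set Q := \sum_(i < N) _ => Q0 a0 us hs.
have ap0 k : 0 <= a k `^ p by exact: powR_ge0.
set E := (\esum_(_ in _) _)%E.
have E0 : (0 <= E)%E by apply: esum_ge0 => k _; rewrite lee_fin.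
have [Ey|] := eqVneq E +oo%E; first by rewrite Ey leey.
rewrite -ltey => Efin.
have Ef : E = (fine E)%:E by rewrite fineK// ge0_fin_numE.
rewrite Ef lee_fin; set e := fine E in Ef *.
have hsum (l : int) : \sum_(k <- s) a (k + l) `^ p <= e.
  rewrite -lee_fin -Ef; rewrite -(big_map (fun k => k + l) predT (fun k => a k `^ p)).
  by apply: sum_le_esum => //; rewrite map_inj_uniq//; exact: addIr.
have NR : 0 < N%:R :> R by rewrite ltr0n.
set beta := (4 * N%:R)^-1.
have beta0 : 0 < beta by rewrite invr_gt0 mulr_gt0.
have W := sum_mul_le b; rewrite -/Q in W.
set w := \sum_(i < N) _ in W.
have step k : k \in s -> beta `^ (p - 1) * (Q / 4) <=
    \sum_(i < N) \sum_(j < N) b i * b j * a (k - i%:Z + j%:Z) `^ p.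
  move=> /hs h.
  apply: (@le_trans _ _ (\sum_(i < N) \sum_(j < N) b i * b j *
     (beta `^ (p - 1) * (a (k - i%:Z + j%:Z) - beta)))); last first.
    apply: ler_sum => i _; apply: ler_sum => j _.
    by rewrite ler_wpM2l ?mulr_ge0// powR_ge_linear.
  have -> : \sum_(i < N) \sum_(j < N) b i * b j *
     (beta `^ (p - 1) * (a (k - i%:Z + j%:Z) - beta)) =
    beta `^ (p - 1) * (\sum_(i < N) \sum_(j < N) b i * b j * a (k - i%:Z + j%:Z) - w * beta).
    rewrite mulr_suml -sumrB mulr_sumr; apply: eq_bigr => i _.
    rewrite mulr_suml -sumrB mulr_sumr; apply: eq_bigr => j _.
    by ring.
  rewrite ler_wpM2l ?powR_ge0//.
  have : w * beta <= Q / 4.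
    have -> : Q / 4 = N%:R * Q * beta by rewrite /beta; field; rewrite gt_eqF.
    by rewrite ler_wpM2r// ltW.
  lra.
have : (size s)%:R * (beta `^ (p - 1) * (Q / 4)) <= N%:R * Q * e.
  apply: (@le_trans _ _ (\sum_(k <- s) \sum_(i < N) \sum_(j < N)
      b i * b j * a (k - i%:Z + j%:Z) `^ p)).
    rewrite [leLHS](_ : _ = \sum_(k <- s) beta `^ (p - 1) * (Q / 4)); last first.
      by rewrite big_const_seq count_predT iter_addr_0 mulr_natl.
    by rewrite big_seq [leRHS]big_seq; apply: ler_sum => k ks; exact: step.
  rewrite exchange_big/=; apply: (@le_trans _ _ (w * e)); last first.
    by rewrite ler_wpM2r// fine_ge0.
  rewrite mulr_suml; apply: ler_sum => i _; rewrite exchange_big/= mulr_suml.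
  apply: ler_sum => j _; rewrite -mulr_sumr ler_wpM2l ?mulr_ge0//.
  by apply: le_trans (hsum (j%:Z - i%:Z)); under eq_bigr do rewrite -addrA [- _ + _]addrC.
have bp : beta `^ p = beta `^ (p - 1) * beta by rewrite mulrC mulr_powRB1// ?ltW//; lra.
rewrite bp => h.
have NQ : 0 < N%:R * Q by exact: mulr_gt0.
rewrite -(ler_pM2l NQ); apply: le_trans h.
rewrite le_eqVlt; apply/orP; left; apply/eqP.
rewrite [X in _ = _ * (_ * X)](_ : _ = N%:R * Q * beta); first by ring.
by rewrite /beta; field; rewrite gt_eqF.
Qed.
End Lp.

Section ApNorm.
Variable R : realType.
Local Notation pi := (@pi R).

Lemma Ap_norm_lower (p : R) (psi : R -> R) (N : nat) (s : seq int) (h : R) :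
  1 <= p -> continuous psi -> 0 < h -> h <= 1 -> 24 <= N%:R * h -> uniq s ->
  (forall k, k \in s -> exists t0 theta, forall t, 0 <= t <= 2 * pi ->
     3 / 4 - 16 / h ^+ 2 * (1 - cos (t - t0)) <= cos (psi t - k%:~R * t - theta)) ->
  (((size s)%:R `^ p^-1 * (4 * N%:R)^-1)%:E <= Ap_norm p (fun t => expi (psi t)))%E.
Proof.
move=> p1 cpsi h0 h1 Nh us hs.
have NR : 24 <= N%:R :> R.
  by apply: le_trans Nh _; rewrite ler_piMr.
have N1 : (1 < N)%N by rewrite -(ltr_nat R); lra.
have N0 : (0 < N)%N by exact: ltnW.
have p0 := @pi_gt0 R; have p0' := @pi_ge0 R.
have b0 (i : 'I_N) : 0 <= sin (i%:R * (pi / N%:R)).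
  apply: sin_ge0_pi; rewrite mulr_ge0 ?divr_ge0//= mulrCA ler_piMr//.
  by rewrite ler_pdivrMr ?ltr0n// mul1r ler_nat ltnW.
have Q0 : 0 < \sum_(i < N) sin (i%:R * (pi / N%:R)) ^+ 2.
  rewrite (bigD1 (Ordinal N1))//= ltr_pwDl ?sumr_ge0// => [|i _]; last exact: sqr_ge0.
  rewrite exprn_gt0// mul1r sin_gt0_pi// divr_gt0 ?ltr0n//=.
  by rewrite ltr_pdivrMr ?ltr0n// ltr_pMr// ltr1n.
pose a k := Normc.normc (fourier_coef (fun t => expi (psi t)) k).
have a0 k : 0 <= a k by rewrite /a; case: fourier_coef => u v; exact: sqrtr_ge0.
have pV0 : 0 <= p^-1 by rewrite invr_ge0; lra.
have bp0 : 0 <= (4 * N%:R)^-1 `^ p :> R by exact: powR_ge0.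
have NV0 : 0 <= (4 * N%:R)^-1 :> R by rewrite invr_ge0 mulr_ge0.
have H : (((size s)%:R * (4 * N%:R)^-1 `^ p)%:E <= \esum_(k in [set: int]) (a k `^ p)%:E)%E.
  apply: (lp_lower_bound p1 N0 b0 Q0 a0 us) => k /hs [t0 [theta]].
  exact: fourier_peak.
have nn0 : (0 <= ((size s)%:R * (4 * N%:R)^-1 `^ p)%:E)%E by rewrite lee_fin mulr_ge0.
have := @gt0_ler_poweR R p^-1 pV0 _ _ _ _ H.
rewrite !in_itv/= !leey !andbT nn0 (le_trans nn0 H) => /(_ isT isT).
apply: le_trans; rewrite /= lee_fin powRM// -powRrM divff ?powRr1//.
by rewrite gt_eqF//; lra.
Qed.

End ApNorm.

(** * Smooth circle maps *)

Section CircleMaps.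
Variable R : realType.
Local Notation pi := (@pi R).

(** Near t0 the mean value theorem bounds the phase by 1/2, and the cosine is
    at least 7/8. Away from t0 the minorant is below -1; for this t0 must be
    at distance h from the ends of [0, 2pi], so that t - t0 avoids 2pi Z. *)
Lemma phase_almost_constant (phi : R -> R) (z : R) (k : int) (t0 h w : R) :
  (forall t, derivable phi t 1) -> 0 < h -> h <= 1 / 4 -> h <= t0 <= 2 * pi - h ->
  (forall c, `|c - t0| <= h -> `|phi^`()%classic c - phi^`()%classic t0| <= w) ->
  `|z| * w * h <= 1 / 4 -> `|z * phi^`()%classic t0 - k%:~R| <= 1 ->
  forall t, 0 <= t <= 2 * pi ->
    3 / 4 - 16 / h ^+ 2 * (1 - cos (t - t0)) <=
    cos (z * phi t - k%:~R * t - (z * phi t0 - k%:~R * t0)).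
Proof.
move=> dphi h0 h4 /andP[ht0 t0h] osc zwh zk t /andP[t_ge0 t_le].
have c1 := cos_le1 (t - t0).
have B0 : 0 <= 16 / h ^+ 2 by rewrite divr_ge0// exprn_ge0// ltW.
case: (leP `|t - t0| h) => tt0.
  have [c ct0 Ec] := MVT_derivable t0 t dphi.
  have -> : z * phi t - k%:~R * t - (z * phi t0 - k%:~R * t0) =
      (z * (phi^`()%classic c - phi^`()%classic t0) +
       (z * phi^`()%classic t0 - k%:~R)) * (t - t0).
    transitivity (z * (phi t - phi t0) - k%:~R * (t - t0)); first by ring.
    by rewrite Ec; ring.
  set a := (_ * _ : R).
  have a2 : `|a| <= 1 / 2.
    rewrite normrM; apply: (@le_trans _ _ ((`|z| * w + 1) * h)); last by lra.
    rewrite ler_pM//; apply: le_trans (ler_normD _ _) _.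
    rewrite lerD// normrM ler_wpM2l// osc//; exact: le_trans tt0.
  have : a ^+ 2 <= (1 / 2) ^+ 2.
    by rewrite -[a ^+ 2]real_normK ?num_real// lerXn2r ?nnegrE//; lra.
  have := cos_ge_parabola a.
  have : 0 <= 16 / h ^+ 2 * (1 - cos (t - t0)) by rewrite mulr_ge0//; lra.
  by lra.
have : h ^+ 2 / 8 <= 1 - cos (t - t0).
  apply: one_sub_cos_lower; first exact: ltW.
  by rewrite (ltW tt0)/= ler_norml; lra.
move=> /(ler_wpM2l B0).
have -> : 16 / h ^+ 2 * (h ^+ 2 / 8) = 2 by field; rewrite gt_eqF.
have := cos_geN1 (z * phi t - k%:~R * t - (z * phi t0 - k%:~R * t0)).
lra.
Qed.

(** The increment over one period is continuous with values in 2pi Z: by the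
    intermediate value theorem it would otherwise take a value in pi + 2pi Z. *)
Lemma circle_map_degree (phi : R -> R) : circle_map phi -> continuous phi ->
  forall s, phi (s + 2 * pi) = phi s + (phi (2 * pi) - phi 0).
Proof.
move=> cm cphi.
pose g s := phi (s + 2 * pi) - phi s.
have cg : continuous g.
  move=> s; apply: cvgB; last exact: cphi.
  apply: (@continuous_comp _ _ _ (fun s => s + 2 * pi) phi); last exact: cphi.
  by apply: cvgD; [exact: cvg_id|exact: cvg_cst].
have gval s : exists m : int, g s = m%:~R * (2 * pi).
  by have [m E] := cm s; exists m; rewrite /g E; ring.
have p0 := @pi_gt0 R.
have jump (m : int) : ~ exists c, g c = m%:~R * (2 * pi) + pi.
  move=> [c]; have [l ->] := gval c => E.
  have /eqP : (2 * l)%:~R = (2 * m + 1)%:~R :> R.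
    apply: (mulIf (lt0r_neq0 p0)); rewrite !rmorphD !rmorphM/=.
    by move: E; set u := l%:~R; set v := m%:~R; lra.
  rewrite eqr_int => /eqP; lia.
have gle x y : x <= y -> g x = g y.
  move=> xy; have [m Em] := gval x; have [m' Em'] := gval y.
  rewrite Em Em'; case: (ltgtP m m') => [mm|mm|->//]; exfalso.
  - apply: (jump m).
    have [||c _ Ec] := @IVT R g x y (m%:~R * (2 * pi) + pi) xy; last by exists c.
      exact: continuous_subspaceT.
    have : (m + 1)%:~R <= m'%:~R :> R by rewrite ler_int lezD1.
    move/(ler_wpM2r (ltW p0)); rewrite rmorphD/= Em Em' => H.
    by rewrite ge_min le_max; apply/andP; split; apply/orP; [left|right]; lra.
  - apply: (jump m').
    have [||c _ Ec] := @IVT R g x y (m'%:~R * (2 * pi) + pi) xy; last by exists c.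
      exact: continuous_subspaceT.
    have : (m' + 1)%:~R <= m%:~R :> R by rewrite ler_int lezD1.
    move/(ler_wpM2r (ltW p0)); rewrite rmorphD/= Em Em' => H.
    by rewrite ge_min le_max; apply/andP; split; apply/orP; [right|left]; lra.
move=> s; have -> : phi (2 * pi) - phi 0 = g 0 by rewrite /g add0r.
have -> : g 0 = g s by case: (leP 0 s) => [/gle//|/ltW/gle ->].
by rewrite /g; ring.
Qed.

Lemma derive1_periodic (phi : R -> R) : circle_map phi ->
  (forall t, derivable phi t 1) ->
  forall s, phi^`()%classic (s + 2 * pi) = phi^`()%classic s.
Proof.
move=> cm dphi s.
have dI (t : R) : is_derive t 1 phi (derive1 phi t) by rewrite derive1E; exact: DeriveDef.
have H := circle_map_degree cm (derivable_continuous dphi).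
have d1 : is_derive s 1 (fun s => phi (s + 2 * pi)) (phi^`()%classic s).
  under [X in is_derive _ _ X _]funext do rewrite H.
  by apply: is_derive_eq; rewrite addr0.
have dS : is_derive s (1 : R) (fun s => s + 2 * pi) (1 : R).
  by apply: is_derive_eq; rewrite addr0.
have d2 : is_derive s 1 (fun s => phi (s + 2 * pi)) (phi^`()%classic (s + 2 * pi)).
  by have := @is_derive1_comp _ phi (fun s => s + 2 * pi) s _ _ (dI _) dS; rewrite mulr1.
by rewrite -(@derive_val _ _ _ _ _ _ _ d1) (@derive_val _ _ _ _ _ _ _ d2).
Qed.

(** The O-constant is made positive, which the nonnegativity of omega allows. *)
Lemma smooth_modulus (omega phi : R -> R) :
  (forall x, 0 <= x -> 0 <= omega x) -> C1_smooth omega phi ->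
  exists C h0 : R, [/\ 0 < C, 0 < h0 & forall h u v, 0 < h <= h0 -> `|u - v| <= h ->
    `|phi^`()%classic u - phi^`()%classic v| <= C * omega h].
Proof.
move=> omega_ge0 [_ [C [e /= e0 He]]].
exists (`|C| + 1), (e / 2); split; [by rewrite ltr_wpDl|lra|].
move=> h u v /andP[h0 he] uv.
have H : (modulus_of_continuity (derive1 phi) h <= (C * omega h)%:E)%E.
  by apply: He => //=; rewrite sub0r normrN gtr0_norm//; lra.
rewrite -lee_fin; apply: le_trans (_ : _ <= (C * omega h)%:E)%E _.
  apply: le_trans H; apply: ereal_sup_ubound.
  by exists (u, v).
rewrite lee_fin ler_wpM2r ?omega_ge0 ?ltW//.
by have := ler_norm C; lra.
Qed.

Lemma derive1_continuous (omega phi : R -> R) (C h0 : R) :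
  {within `[0, +oo[, continuous omega} -> omega 0 = 0 -> 0 < C -> 0 < h0 ->
  (forall h u v, 0 < h <= h0 -> `|u - v| <= h ->
    `|phi^`()%classic u - phi^`()%classic v| <= C * omega h) ->
  continuous phi^`()%classic.
Proof.
move=> co o0 C0 h00 mod t; apply/cvgrPdist_le => e e0.
have co0 : omega x @[x --> 0^'+] --> omega 0.
  by move/continuous_within_itvcyP : co => [_].
rewrite o0 in co0.
have [h [h0h [hh0 oh]]] : exists h, 0 < h /\ h <= h0 /\ omega h <= e / C.
  have eC : 0 < e / C by rewrite divr_gt0.
  have /cvgrPdist_le/(_ _ eC) hn := co0.
  near (0 : R)^'+ => h; exists h; split => //; split => //.
    by near: h; exact: nbhs_right_le.
  have : `|0 - omega h| <= e / C by near: h.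
  by rewrite sub0r normrN; apply: le_trans; exact: ler_norm.
near=> x.
apply: (@le_trans _ _ (C * omega h)).
  apply: mod; first by rewrite h0h.
  by near: x; exact: cvgr_dist_le.
by rewrite mulrC -ler_pdivlMr.
Unshelve. all: by end_near. Qed.

(** A derivative that is constant on one period is constant everywhere, by
    periodicity. *)
Lemma nonaffine_derive1 (phi : R -> R) : circle_map phi ->
  (forall t, derivable phi t 1) -> ~ affine phi ->
  exists2 t, 0 <= t <= 2 * pi & phi^`()%classic t != phi^`()%classic 0.
Proof.
move=> cm dphi naff; apply: contrapT => H; apply: naff.
have p2 := @pi2_gt0 R.
have Hc t : 0 <= t <= 2 * pi -> phi^`()%classic t = phi^`()%classic 0.
  move=> t02; apply: contrapT => /eqP ne; apply: H; exists t => //.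
have per := derive1_periodic cm dphi.
have pern (n : nat) t : phi^`()%classic (t + n%:R * (2 * pi)) = phi^`()%classic t.
  elim: n => [|n IH]; first by rewrite mul0r addr0.
  have -> : t + n.+1%:R * (2 * pi) = t + n%:R * (2 * pi) + 2 * pi by rewrite -natr1; ring.
  by rewrite per.
have const t : phi^`()%classic t = phi^`()%classic 0.
  pose m := Num.floor (t / (2 * pi)).
  have [m1 m2] : m%:~R * (2 * pi) <= t /\ t <= m%:~R * (2 * pi) + 2 * pi.
    have := floor_itv (t / (2 * pi)); rewrite -/m => /andP[].
    rewrite ler_pdivlMr// ltr_pdivrMr// rmorphD/= => ? ?; split => //.
    lra.
  case: (intP m) m1 m2 => [|n|n].
  - by rewrite mul0r add0r => ? ?; apply: Hc; apply/andP.
  - rewrite -[n.+1%:~R]/(n.+1%:R) => m1 m2.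
    have -> : t = (t - n.+1%:R * (2 * pi)) + n.+1%:R * (2 * pi) by ring.
    by rewrite pern; apply: Hc; apply/andP; split; lra.
  - rewrite mulrNz -[n.+1%:~R]/(n.+1%:R) => m1 m2.
    by rewrite -(pern n.+1); apply: Hc; apply/andP; split; lra.
exists (phi^`()%classic 0), (phi 0) => t.
have [c _] := MVT_derivable 0 t dphi.
by rewrite const subr0 => E; rewrite -E; ring.
Qed.

(** By periodicity the derivative takes at some u inside ]0, 2pi[ a value
    different from its value at another such point t; the intermediate value
    theorem between u and t then produces all the values in between, at points
    of a compact subset of ]0, 2pi[. *)
Lemma derive1_range (phi : R -> R) : circle_map phi ->
  (forall t, derivable phi t 1) -> continuous phi^`()%classic -> ~ affine phi ->
  exists d A B : R, [/\ 0 < d, A < B & forall y, A <= y <= B ->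
    exists2 t0, d <= t0 <= 2 * pi - d & phi^`()%classic t0 = y].
Proof.
move=> cm dphi cphi naff; set f := phi^`()%classic in cphi *.
have [t /andP[t0 t2] ft] := nonaffine_derive1 cm dphi naff.
rewrite -/f in ft.
have t2' : t < 2 * pi.
  rewrite lt_neqAle t2 andbT; apply: contra_neq ft => ->.
  by rewrite -[2 * pi]add0r /f derive1_periodic.
have [||u] := @IVT R f 0 t ((f 0 + f t) / 2) t0.
- exact: continuous_subspaceT.
- by case: (leP (f 0) (f t)) => ?; apply/andP; split; lra.
rewrite in_itv/= => /andP[u0 ut] fu.
have u0' : 0 < u.
  rewrite lt_neqAle u0 andbT; apply: contra_neq ft => u00; move: fu; rewrite -u00; lra.
exists (Num.min u (2 * pi - t)), (Num.min (f u) (f t)), (Num.max (f u) (f t)); split.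
- by rewrite lt_min u0'/=; lra.
- rewrite lt_max !gt_min !ltxx orbF /= -neq_lt.
  by apply: contra_neq ft => E; lra.
move=> y yfu; have [|c] := @IVT R f u t y ut _ yfu.
  exact: continuous_subspaceT.
rewrite in_itv/= => /andP[uc ct] fc; exists c => //.
rewrite ge_min uc/= lerBrDr -lerBrDl ge_min; apply/orP; right; lra.
Qed.

End CircleMaps.

(** The frequencies z y with y = A + r/|z| are translates of z A by integers;
    rounding z A once makes all of them integers. *)
Lemma integer_frequencies (R : realType) (z A B : R) : z != 0 -> A < B ->
  exists s : seq int, [/\ uniq s, `|z| * (B - A) <= (size s)%:R &
    forall k, k \in s -> exists2 y, A <= y <= B & `|z * y - k%:~R| <= 1].
Proof.
move=> z0 AB; have zn : 0 < `|z| by rewrite normr_gt0.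
pose sg : int := if 0 < z then 1 else -1.
have sgE : z / `|z| = sg%:~R.
  rewrite /sg; case: (ltgtP 0 z) z0 => // z0 _.
    by rewrite gtr0_norm// divff// gt_eqF.
  by rewrite ltr0_norm// invrN mulrN divff ?lt_eqF// rmorphN.
have len0 : 0 <= `|z| * (B - A) by rewrite mulr_ge0//; lra.
have [M1 M2] : (Num.truncn (`|z| * (B - A)))%:R <= `|z| * (B - A) /\
    `|z| * (B - A) < (Num.truncn (`|z| * (B - A))).+1%:R.
  by have /andP[] := truncn_itv len0.
move: (Num.truncn _) M1 M2 => M M1 M2.
exists [seq Num.floor (z * A) + sg * r%:Z | r <- iota 0 M.+1]; split.
- rewrite map_inj_uniq ?iota_uniq// => r r'; rewrite /sg; case: ifP => _; lia.
- by rewrite size_map size_iota ltW.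
move=> k /mapP[r]; rewrite mem_iota add0n ltnS => /andP[_ rM] ->.
have rMR : r%:R <= M%:R :> R by rewrite ler_nat.
exists (A + r%:R / `|z|).
  rewrite lerDl divr_ge0//= -lerBrDl ler_pdivrMr//; lra.
have -> : z * (A + r%:R / `|z|) = z * A + sg%:~R * r%:R by rewrite -sgE; ring.
rewrite rmorphD rmorphM/= -pmulrn opprD addrACA subrr addr0.
have /andP[f1 f2] := floor_itv (z * A).
by rewrite rmorphD/= in f2; rewrite ler_norml; apply/andP; split; lra.
Qed.

(** * The inverse of chi *)

(** Outside the image the partial inverse takes its default value; for chi this
    value is 0, which makes the lower bound trivial there. This spares the
    surjectivity of chi. *)
Lemma pinv_default_or_preimage (T U : Type) (d : U -> T) (A : set T) (f : T -> U) y :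
  let x := 'pinv_d A f y in x = d y \/ A x /\ f x = y.
Proof.
rewrite /pinv_ splitV /=.
have -> : 'oinv_[fun f in A] y = _ := oinv_surj _ y.
case: pselect => [im|_] /=; last by left.
by right; case: cid2.
Qed.

Lemma chi_inv_spec (R : realType) (omega : R -> R) (y : R) : 0 < y ->
  chi_inv omega y = 0 \/
  0 < chi_inv omega y /\ chi_inv omega y * omega (chi_inv omega y) = y.
Proof.
move=> y0; rewrite /chi_inv.
have /= [->|[]] := pinv_default_or_preimage (fun=> 0) `[0, +oo[ (chi omega) y; first by left.
set x := 'pinv_ _ _ _ _; rewrite /= in_itv/= andbT => x0 xE; right; split => //.
rewrite lt_neqAle x0 andbT; apply/eqP => x00.
by move: xE y0; rewrite /chi -x00 mul0r => <-; rewrite ltxx.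
Qed.

(** * The lower bound *)

Theorem theorem3 (R : realType) (p : R) (hp : 1 <= p < 2)
    (omega : R -> R)
    (omega_cont : {within `[0, +oo[, continuous omega})
    (omega_nondecr : {in `[0, +oo[ &, {homo omega : x y / x <= y}})
    (omega0 : omega 0 = 0)
    (phi : R -> R)
    (phi_circle : circle_map phi)
    (phi_smooth : C1_smooth omega phi)
    (phi_nonlinear : ~ affine phi) :
  exists2 c : R, 0 < c &
    forall n : int, n != 0 ->
      ((c * (`|n|%:~R `^ p^-1) * chi_inv omega (`|n|%:~R)^-1)%:E
         <= Ap_norm p (fun t => expi (n%:~R * phi t)))%E.
Proof.
have omega_mono x y : 0 <= x -> x <= y -> omega x <= omega y.
  by move=> x0 xy; apply: omega_nondecr => //; rewrite in_itv/= andbT// (le_trans x0).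
have omega_ge0 x : 0 <= x -> 0 <= omega x.
  by move=> x0; rewrite -omega0 omega_mono.
have dphi := phi_smooth.1.
have [C [h0 [C0 h00 mod]]] := smooth_modulus omega_ge0 phi_smooth.
have cdphi := derive1_continuous omega_cont omega0 C0 h00 mod.
have [d [A [B [d0 AB range]]]] := derive1_range phi_circle dphi cdphi phi_nonlinear.
have p1 : 1 <= p by case/andP: hp.
have normV (n : int) : n != 0 -> 0 < (`|n|%:~R)^-1 :> R.
  by move=> n0; rewrite invr_gt0 ltr0z normr_gt0.
have trivial_bound (c : R) (n : int) : chi_inv omega (`|n|%:~R)^-1 = 0 ->
   ((c * (`|n|%:~R `^ p^-1) * chi_inv omega (`|n|%:~R)^-1)%:E
         <= Ap_norm p (fun t => expi (n%:~R * phi t)))%E.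
  by move=> ->; rewrite mulr0 poweR_ge0.
have [[x1 [x10 ox1]]|om0] := pselect (exists x1, 0 < x1 /\ 0 < omega x1); last first.
  (* If omega vanishes then so does chi, and chi_inv takes its default value. *)
  exists 1 => // n n0; apply: trivial_bound.
  have [//|[dl0 dlE]] := chi_inv_spec omega (normV n n0).
  exfalso; apply: om0; exists (chi_inv omega (`|n|%:~R)^-1); split => //.
  by rewrite -(pmulr_rgt0 _ dl0) dlE normV.
(* D bounds chi_inv (1/|n|) for every n != 0: beyond x1, chi grows at least
   linearly with slope omega x1, and chi equals 1/|n| <= 1 there. Thanks to D,
   eta can be fixed before n so that h = eta * delta meets all smallness
   conditions: on the modulus of continuity, on the distance from t0 to the
   ends of the period, and on the phase error. *)
pose D := x1 + (omega x1)^-1.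
have D0 : 0 < D by rewrite addr_gt0// invr_gt0.
pose m := Num.min (Num.min h0 d) (1 / 4).
have m0 : 0 < m by rewrite !lt_min h00 d0/=; lra.
pose eta := Num.min (m / D) (Num.min 1 (4 * C)^-1).
have eta0 : 0 < eta by rewrite !lt_min divr_gt0//= ltr01 invr_gt0 mulr_gt0.
have etaD : eta * D <= m by rewrite -ler_pdivlMr// ge_min lexx.
have eta1 : eta <= 1 by rewrite !ge_min lexx orbT.
have etaC : eta * C <= 1 / 4.
  have : eta <= (4 * C)^-1 by rewrite !ge_min lexx !orbT.
  move/(ler_wpM2r (ltW C0)); have -> : (4 * C)^-1 * C = 1 / 4 by field; rewrite gt_eqF.
  by [].
exists ((B - A) `^ p^-1 * (eta / 100)).
  by rewrite mulr_gt0 ?powR_gt0 ?divr_gt0// subr_gt0.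
move=> n n0.
have [/trivial_bound//|] := chi_inv_spec omega (normV n n0).
set delta := chi_inv omega _ => -[dl0 dlE].
have zE : `|n|%:~R = `|n%:~R| :> R by rewrite intr_norm.
rewrite zE in dlE *; set z : R := n%:~R in dlE *.
have z0 : z != 0 by rewrite intr_eq0.
have z1 : 1 <= `|z| by rewrite -zE ler1z -gtz0_ge1 normr_gt0.
have zn : 0 < `|z| by lra.
have dlD : delta <= D.
  have o1 : 0 < (omega x1)^-1 by rewrite invr_gt0.
  rewrite /D; case: (leP delta x1) => dx; first by lra.
  suff : delta <= (omega x1)^-1 by lra.
  rewrite -[leRHS]mul1r ler_pdivlMr//.
  apply: (@le_trans _ _ (delta * omega delta)).
    by rewrite ler_wpM2l ?(ltW dl0)// omega_mono// ltW.
  by rewrite dlE invf_le1.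
pose h := eta * delta.
have h_gt0 : 0 < h by rewrite mulr_gt0.
have hm : h <= m by apply: le_trans etaD; rewrite ler_wpM2l// ltW.
have hh0 : h <= h0 by apply: le_trans hm _; rewrite !ge_min lexx.
have hd : h <= d by apply: le_trans hm _; rewrite !ge_min lexx orbT.
have h4 : h <= 1 / 4 by apply: le_trans hm _; rewrite !ge_min lexx !orbT.
have hdl : h <= delta by rewrite ler_piMl// ltW.
have osc : `|z| * (C * omega h) * h <= 1 / 4.
  apply: le_trans etaC.
  have : `|z| * (C * omega h) * h <= `|z| * (C * omega delta) * h.
    rewrite ler_wpM2r ?(ltW h_gt0)// ler_wpM2l// ler_wpM2l ?(ltW C0)// omega_mono//.
    exact: ltW.
  move/le_trans; apply.
  have -> : `|z| * (C * omega delta) * h = eta * C * (`|z| * (delta * omega delta)).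
    by rewrite /h; ring.
  by rewrite dlE divff ?mulr1// gt_eqF.
have [s [us ssize sfreq]] := integer_frequencies z0 AB.
(* As h <= 1, the least admissible N is at most 25 / h. *)
have [N [N1 N2]] : exists N : nat, 24 <= N%:R * h /\ N%:R * h <= 25.
  exists (Num.truncn (24 / h)).+1.
  have /truncn_itv/andP[t1 t2] : 0 <= 24 / h by rewrite divr_ge0// ltW.
  split; first by rewrite -ler_pdivrMr// ltW.
  by rewrite -natr1 mulrDl mul1r; rewrite ler_pdivlMr// in t1; lra.
have N0 : 0 < N%:R :> R by rewrite -(pmulr_lgt0 _ h_gt0); lra.
have cpsi : continuous (fun t => z * phi t).
  exact: continuous_scale (derivable_continuous dphi).
have := @Ap_norm_lower R p (fun t => z * phi t) N s h p1 cpsi h_gt0 _ N1 us.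
move=> /(_ _ _)/(le_trans _); apply; last 2 first.
- lra.
- move=> k /sfreq [y yAB zyk]; have [t0 t0d t0y] := range y yAB.
  exists t0, (z * phi t0 - k%:~R * t0).
  apply: (@phase_almost_constant R phi z k t0 h (C * omega h)) => //.
  + by case/andP: t0d => ? ?; apply/andP; split; lra.
  + by move=> c ct0; apply: mod; rewrite // h_gt0.
  + by rewrite t0y.
rewrite lee_fin.
have BA : 0 <= B - A by lra.
have pV0 : 0 <= p^-1 by rewrite invr_ge0; lra.
have -> : (B - A) `^ p^-1 * (eta / 100) * `|z| `^ p^-1 * delta =
   (`|z| * (B - A)) `^ p^-1 * (h / 100) by rewrite powRM// /h; ring.
rewrite ler_pM ?powR_ge0 ?divr_ge0//; first exact: ltW.
  by apply: ge0_ler_powR; rewrite // nnegrE// mulr_ge0.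
by rewrite ler_pdivrMr// mulrC ler_pdivlMr ?mulr_gt0//; lra.
Qed.
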